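(* Let $\mathcal F$ be any family of generalized dependencies. Then every sentence of $\mathrm{FO}(\sim_0,\mathcal F)$ is equivalent to some first-order sentence if and only if every sentence of $\mathrm{FO}(\mathcal F,\sim\mathcal F)$ is equivalent to some first-order sentence.
   Context: Team Semantics: all first-order models have domains with at least two elements; first-order formulas are in negation normal form. A team $X$ over a model $\mathfrak M$ with domain $M$ is a set of assignments $s:V\to M$ for a fixed finite set of variables $V$; $X(\bar v)=\{s(\bar v):s\in X\}$. Satisfaction $\mathfrak M\models_X\phi$: for a first-order literal $\alpha$, iff $\mathfrak M\models_s\alpha$ for all $s\in X$; $\phi_1\vee\phi_2$ iff $X=Y\cup Z$ with $\mathfrak M\models_Y\phi_1$, $\mathfrak M\models_Z\phi_2$; $\phi_1\wedge\phi_2$ iff both hold; $\exists v\psi$ iff there is $H:X\to\mathcal P(M)\setminus\{\emptyset\}$ with $\mathfrak M\models_{X[H/v]}\psi$, $X[H/v]=\{s[m/v]:s\in X,m\in H(s)\}$; $\forall v\psi$ iff $\mathfrak M\models_{X[M/v]}\psi$, $X[M/v]=\{s[m/v]:s\in X,m\in M\}$. A sentence is true in $\mathfrak M$ iff satisfied by $\{\emptyset\}$. A $k$-ary generalized dependency is a class $\mathcal D$ of structures $(M,R)$, $R\subseteq M^k$, closed under isomorphism; the atom $\mathcal D\bar x$ is satisfied by $X$ iff $(M,X(\bar x))\in\mathcal D$. $\mathrm{FO}(\mathcal F)$ is first-order logic with Team Semantics extended with the atoms of $\mathcal F$. The complement of $\mathcal D$ is $\sim\mathcal D=\{(M,R):(M,R)\notin\mathcal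 D\}$ and $\sim\mathcal F=\{\sim\mathcal D:\mathcal D\in\mathcal F\}$. The contradictory negation has semantics $\mathfrak M\models_X\sim\phi$ iff $\mathfrak M\not\models_X\phi$; $\mathrm{FO}(\sim_0,\mathcal F)$ is $\mathrm{FO}(\mathcal F)$ extended by allowing $\sim$ only directly in front of first-order literals and dependency atoms $\mathcal D\bar x$ with $\mathcal D\in\mathcal F$. *)

(* Defs.v *)
From mathcomp Require Import all_boot finmap.
From mathcomp Require Import boolp classical_sets.

Set Implicit Arguments.
Unset Strict Implicit.
Unset Printing Implicit Defensive.

Local Open Scope fmap_scope.
Local Open Scope classical_set_scope.

Record signature := Signature {
  fsym : Type;
  rsym : Type;
  farity : fsym -> nat;
  rarity : rsym -> nat }.

Record model (sg : signature) := Model {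
  dom :> Type;
  finterp : forall f : fsym sg, ('I_(farity f) -> dom) -> dom;
  rinterp : forall r : rsym sg, set ('I_(rarity r) -> dom);
  two_elements : exists a b : dom, a <> b }.

(* A class of structures (M, R) with R a [arity]-ary relation on M. Taking
   h := id in [dep_iso] shows that membership depends only on the extension
   of R. *)
Record dependency := Dependency {
  arity : nat;
  dep_class : forall M : Type, set ('I_arity -> M) -> Prop;
  dep_iso : forall (M N : Type) (h : M -> N)
      (R : set ('I_arity -> M)) (S : set ('I_arity -> N)),
    bijective h -> (forall a, R a <-> S (h \o a)) ->
    (dep_class R <-> dep_class S) }.

Lemma dep_compl_iso (D : dependency) (M N : Type) (h : M -> N)
    (R : set ('I_(arity D) -> M)) (S : set ('I_(arity D) -> N)) :
  bijective h -> (forall a, R a <-> S (h \o a)) ->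
  (~ dep_class R <-> ~ dep_class S).
Proof.
move=> bij_h hRS; have [RS SR] := dep_iso bij_h hRS.
by split=> nD HD; apply: nD; [apply: SR | apply: RS].
Qed.

Definition dep_compl (D : dependency) : dependency :=
  @Dependency (arity D) (fun M R => ~ @dep_class D M R) (@dep_compl_iso D).

Section Syntax.
Variable sg : signature.

Inductive term :=
| Var (v : nat)
| App (f : fsym sg) (t : 'I_(farity f) -> term).

Inductive literal :=
| Rel (r : rsym sg) (t : 'I_(rarity r) -> term)
| NRel (r : rsym sg) (t : 'I_(rarity r) -> term)
| Eq (t u : term)
| NEq (t u : term).

(* [Sim] is the contradictory negation, with no syntactic restriction here;
   the logics considered are fragments of this syntax. *)
Inductive formula :=
| Lit (l : literal)
| Dep (D : dependency) (x : 'I_(arity D) -> nat)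
| Sim (phi : formula)
| And (phi psi : formula)
| Or (phi psi : formula)
| Ex (v : nat) (phi : formula)
| All (v : nat) (phi : formula).

Fixpoint term_var (t : term) (v : nat) : Prop :=
  match t with
  | Var w => v = w
  | App f ts => exists i, term_var (ts i) v
  end.

Definition literal_var (l : literal) (v : nat) : Prop :=
  match l with
  | Rel r ts | NRel r ts => exists i, term_var (ts i) v
  | Eq t u | NEq t u => term_var t v \/ term_var u v
  end.

Fixpoint free (phi : formula) (v : nat) : Prop :=
  match phi with
  | Lit l => literal_var l v
  | Dep D x => exists i, v = x i
  | Sim phi => free phi v
  | And phi psi | Or phi psi => free phi v \/ free psi v
  | Ex w phi | All w phi => v <> w /\ free phi v
  end.

Definition sentence (phi : formula) : Prop := forall v, ~ free phi v.

(* FO(F) *)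
Fixpoint FO (F : set dependency) (phi : formula) : Prop :=
  match phi with
  | Lit _ => True
  | Dep D _ => F D
  | Sim _ => False
  | And phi psi | Or phi psi => FO F phi /\ FO F psi
  | Ex _ phi | All _ phi => FO F phi
  end.

Definition first_order (phi : formula) : Prop := FO set0 phi.

(* FO(~0, F) *)
Fixpoint FO_sim0 (F : set dependency) (phi : formula) : Prop :=
  match phi with
  | Lit _ => True
  | Dep D _ => F D
  | Sim (Lit _) => True
  | Sim (Dep D _) => F D
  | Sim _ => False
  | And phi psi | Or phi psi => FO_sim0 F phi /\ FO_sim0 F psi
  | Ex _ phi | All _ phi => FO_sim0 F phi
  end.

End Syntax.

Section Semantics.
Variables (sg : signature) (M : model sg).

Definition assignment := {fmap nat -> M}.

(* All the members of a team share the same domain; this holds of the team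
   consisting of the empty assignment and is preserved by every clause of
   [sat]. *)
Definition team := set assignment.

(* The graph of term evaluation: [value s t m] means that t denotes m under s,
   which requires the variables of t to be in the domain of s. *)
Fixpoint value (s : assignment) (t : term sg) (m : M) : Prop :=
  match t with
  | Var v => s.[? v] = Some m
  | App f ts => exists a : 'I_(farity f) -> M,
      (forall i, value s (ts i) (a i)) /\ finterp a = m
  end.

Definition sat_literal (s : assignment) (l : literal sg) : Prop :=
  match l with
  | Rel r ts => exists a : 'I_(rarity r) -> M,
      (forall i, value s (ts i) (a i)) /\ rinterp a
  | NRel r ts => exists a : 'I_(rarity r) -> M,
      (forall i, value s (ts i) (a i)) /\ ~ rinterp a
  | Eq t u => exists a b : M, value s t a /\ value s u b /\ a = b
  | NEq t u => exists a b : M, value s t a /\ value s u b /\ a <> b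
  end.

(* X(x) *)
Definition team_rel (X : team) k (x : 'I_k -> nat) : set ('I_k -> M) :=
  [set a | exists2 s, X s & forall i, s.[? x i] = Some (a i)].

(* X[H/v] *)
Definition supplement (X : team) (H : assignment -> set M) (v : nat) : team :=
  [set s' | exists s m, X s /\ H s m /\ s' = s.[v <- m]].

Fixpoint sat (X : team) (phi : formula sg) : Prop :=
  match phi with
  | Lit l => forall s, X s -> sat_literal s l
  | Dep D x => dep_class (team_rel X x)
  | Sim phi => ~ sat X phi
  | And phi psi => sat X phi /\ sat X psi
  | Or phi psi => exists Y Z : team, X = Y `|` Z /\ sat Y phi /\ sat Z psi
  | Ex v phi => exists H : assignment -> set M,
      (forall s, X s -> H s !=set0) /\ sat (supplement X H v) phi
  | All v phi => sat (supplement X (fun=> setT) v) phi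
  end.

Definition true_in (phi : formula sg) : Prop := sat [set [fmap]] phi.

End Semantics.

Definition equivalent sg (phi psi : formula sg) : Prop :=
  forall M : model sg, true_in M phi <-> true_in M psi.

Definition sentences_first_order (L : forall sg, formula sg -> Prop) : Prop :=
  forall (sg : signature) (phi : formula sg), L sg phi -> sentence phi ->
  exists psi : formula sg,
    [/\ first_order psi, sentence psi & equivalent phi psi].

(* Main.v *)
(* Replacing [Sim (Dep D x)] by the atom of the complement of D and conversely
   settles everything except the negated literals. A negated literal asks that
   the team contain an assignment falsifying the literal, which no formula of
   FO(F, ~F) need express locally. Instead, the signature is expanded by
   constants c naming the values of one assignment s0 at each quantifier on the
   path to the literal, and the formula is rewritten so that s0 survives in the
   team along that path: before a disjunction or an existential quantifier, a
   fresh universally quantified variable w duplicates the team, and the copies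
   of s0 with w = c 0 are forced to the right disjunct or to the named value,
   whereas the other copies stay free. The original sentence is true in M iff
   the rewritten one is true in (M, c) for some c. Negated literals disappear
   one by one, and the constants of the first-order sentence finally obtained
   are turned into existentially quantified variables, which is legitimate
   because first-order formulas are flat. *)
Require Import Defs.
From mathcomp Require Import all_boot finmap boolp classical_sets.

Set Implicit Arguments.
Unset Strict Implicit.
Unset Printing Implicit Defensive.

Local Open Scope fmap_scope.
Local Open Scope classical_set_scope.

(** * Dependency atoms and their complements *)

(** On every team an atom of [dep_compl D] means the same as [Sim] in front of the atom of [D]. The
    clause on free variables makes sentences go to sentences. *)
Lemma FO_compl_to_FO_sim0 (F : set dependency) sg (phi : formula sg) :
  FO (F `|` dep_compl @` F) phi ->
  exists psi : formula sg, [/\ FO_sim0 F psi,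
    forall v, free psi v -> free phi v &
    forall (M : model sg) (X : team M), sat X phi <-> sat X psi].
Proof.
elim: phi => [l|D x|//|phi IHp psi IHq|phi IHp psi IHq|v phi IHp|v phi IHp] /=.
- by exists (Lit l).
- case=> [FD|[D' FD' eD]]; first by exists (@Dep sg D x).
  (* Eliminating the equality with [x] generalized turns [D] into [dep_compl D'], whose arity
     computes to that of [D']. *)
  by case: _ / eD x => x; exists (Sim (@Dep sg D' x)).
- move=> [/IHp[p [Fp fp ep]] /IHq[q [Fq fq eq]]]; exists (And p q); split=> //.
    by move=> v [/fp|/fq]; [left|right].
  by move=> M X /=; rewrite ep eq.
- move=> [/IHp[p [Fp fp ep]] /IHq[q [Fq fq eq]]]; exists (Or p q); split=> //.
    by move=> v [/fp|/fq]; [left|right].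
  by move=> M X /=; split=> -[Y [Z [-> [/ep HY /eq HZ]]]]; exists Y, Z.
- move=> /IHp[p [Fp fp ep]]; exists (Ex v p); split=> //.
    by move=> u [? /fp].
  by move=> M X /=; split=> -[H [H0 /ep HH]]; exists H.
- move=> /IHp[p [Fp fp ep]]; exists (All v p); split=> //.
  by move=> u [? /fp].
Qed.

Fixpoint sim_lits sg (phi : formula sg) : nat :=
  match phi with
  | Sim (Lit _) => 1
  | And p q | Or p q => sim_lits p + sim_lits q
  | Ex _ p | All _ p => sim_lits p
  | _ => 0
  end.

Lemma FO_sim0_to_FO_compl (F : set dependency) sg (phi : formula sg) :
  FO_sim0 F phi -> sim_lits phi = 0 ->
  exists psi : formula sg, [/\ FO (F `|` dep_compl @` F) psi,
    forall v, free psi v -> free phi v &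
    forall (M : model sg) (X : team M), sat X phi <-> sat X psi].
Proof.
elim: phi => [l|D x|phi _|phi IHp psi IHq|phi IHp psi IHq|v phi IHp|v phi IHp] /=.
- by exists (Lit l).
- by move=> FD _; exists (@Dep sg D x); split=> //; left.
- case: phi => // D x FD _; exists (@Dep sg (dep_compl D) x).
  by split=> //=; right; exists D.
- move=> [Fp Fq] /eqP; rewrite addn_eq0 => /andP[/eqP sp /eqP sq].
  have [p [Fp' fp ep]] := IHp Fp sp; have [q [Fq' fq eq]] := IHq Fq sq.
  exists (And p q); split=> //.
    by move=> v [/fp|/fq]; [left|right].
  by move=> M X /=; rewrite ep eq.
- move=> [Fp Fq] /eqP; rewrite addn_eq0 => /andP[/eqP sp /eqP sq].
  have [p [Fp' fp ep]] := IHp Fp sp; have [q [Fq' fq eq]] := IHq Fq sq.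
  exists (Or p q); split=> //.
    by move=> v [/fp|/fq]; [left|right].
  by move=> M X /=; split=> -[Y [Z [-> [/ep HY /eq HZ]]]]; exists Y, Z.
- move=> Fp sp; have [p [Fp' fp ep]] := IHp Fp sp; exists (Ex v p); split=> //.
    by move=> u [? /fp].
  by move=> M X /=; split=> -[H [H0 /ep HH]]; exists H.
- move=> Fp sp; have [p [Fp' fp ep]] := IHp Fp sp; exists (All v p); split=> //.
  by move=> u [? /fp].
Qed.

(** * Values of terms, bounds on variables, locality *)

Definition negate_literal sg (l : literal sg) : literal sg :=
  match l with
  | Rel r t => NRel t
  | NRel r t => Rel t
  | Eq t u => NEq t u
  | NEq t u => Eq t u
  end.

Section Terms.
Variables (sg : signature) (M : model sg).
Implicit Types (s : assignment M) (t : term sg).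

Lemma value_inj s t m m' : value s t m -> value s t m' -> m = m'.
Proof.
elim: t m m' => [v|f ts IH] m m' /=; first by move=> -> [].
move=> [a [Ha <-]] [b [Hb <-]]; congr finterp.
by apply: funext => i; apply: IH (Ha i) (Hb i).
Qed.

Lemma value_total s t : (forall v, term_var t v -> s.[? v] <> None) ->
  exists m, value s t m.
Proof.
elim: t => [v|f ts IH] /= Ht.
  by move: (Ht v erefl); case: s.[? v] => // m _; exists m.
have /choice[a Ha] i : exists m, value s (ts i) m.
  by apply: IH => v vi; apply: Ht; exists i.
by exists (finterp a), a.
Qed.

Lemma sat_negate_literal s (l : literal sg) :
  sat_literal s (negate_literal l) -> ~ sat_literal s l.
Proof.
case: l => [r t|r t|t u|t u] /=.
- move=> [a [Ha na]] [b [Hb hb]]; apply: na.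
  suff -> : a = b by [].
  by apply: funext => i; apply: value_inj (Ha i) (Hb i).
- move=> [b [Hb hb]] [a [Ha na]]; apply: na.
  suff -> : a = b by [].
  by apply: funext => i; apply: value_inj (Ha i) (Hb i).
- move=> [a [b [Ha [Hb nab]]]] [a' [b' [Ha' [Hb' eab]]]]; apply: nab.
  by rewrite (value_inj Ha Ha') (value_inj Hb Hb').
- move=> [a' [b' [Ha' [Hb' eab]]]] [a [b [Ha [Hb nab]]]]; apply: nab.
  by rewrite (value_inj Ha Ha') (value_inj Hb Hb').
Qed.

(** Evaluation is partial: if some variable of [l] is undefined, both [l] and its dual fail, hence
    the condition on the domain of [s]. *)
Lemma negate_literal_sat s (l : literal sg) :
  (forall v, literal_var l v -> s.[? v] <> None) ->
  ~ sat_literal s l -> sat_literal s (negate_literal l).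
Proof.
case: l => [r ts|r ts|t u|t u] /= Hl nl.
- have /choice[a Ha] i : exists m, value s (ts i) m.
    by apply: value_total => v vi; apply: Hl; exists i.
  by exists a; split=> // ra; apply: nl; exists a.
- have /choice[a Ha] i : exists m, value s (ts i) m.
    by apply: value_total => v vi; apply: Hl; exists i.
  by exists a; split=> //; apply: contrapT => ra; apply: nl; exists a.
- have [v tv|a Ha] := @value_total s t; first by apply: Hl; left.
  have [v tv|b Hb] := @value_total s u; first by apply: Hl; right.
  by exists a, b; do !split=> //; move=> eab; apply: nl; exists a, b.
- have [v tv|a Ha] := @value_total s t; first by apply: Hl; left.
  have [v tv|b Hb] := @value_total s u; first by apply: Hl; right.
  exists a, b; do !split=> //; apply: contrapT => eab; apply: nl.
  by exists a, b.
Qed.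

Fixpoint term_bound t : nat :=
  match t with
  | Var v => v.+1
  | App f ts => \max_(i < farity f) term_bound (ts i)
  end.

Definition literal_bound (l : literal sg) : nat :=
  match l with
  | Rel r ts | NRel r ts => \max_(i < rarity r) term_bound (ts i)
  | Eq t u | NEq t u => maxn (term_bound t) (term_bound u)
  end.

(** Quantified variables are counted as well, so the variable numbered [var_bound phi] occurs
    nowhere in [phi]. *)
Fixpoint var_bound (phi : formula sg) : nat :=
  match phi with
  | Lit l => literal_bound l
  | Dep D x => \max_(i < arity D) (x i).+1
  | Sim p => var_bound p
  | And p q | Or p q => maxn (var_bound p) (var_bound q)
  | Ex v p | All v p => maxn v.+1 (var_bound p)
  end.

Lemma term_var_bound t v : term_var t v -> v < term_bound t.
Proof.
elim: t => [u -> //|f ts IH] /= [i /IH vi].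
by apply: leq_trans vi _; apply: (leq_bigmax (F := fun i => term_bound (ts i)) i).
Qed.

Lemma literal_var_bound N l v : literal_bound l <= N -> literal_var l v -> v < N.
Proof.
move=> bl lv; apply: leq_trans bl.
case: l lv => [r ts|r ts|t u|t u] /=.
- move=> [i /term_var_bound vi]; apply: leq_trans vi _.
  exact: (leq_bigmax (F := fun i => term_bound (ts i)) i).
- move=> [i /term_var_bound vi]; apply: leq_trans vi _.
  exact: (leq_bigmax (F := fun i => term_bound (ts i)) i).
- by rewrite leq_max => -[/term_var_bound ->|/term_var_bound ->]; rewrite ?orbT.
- by rewrite leq_max => -[/term_var_bound ->|/term_var_bound ->]; rewrite ?orbT.
Qed.

Definition agree N s s' := forall v, v < N -> s.[? v] = s'.[? v].

Lemma agree_sym N s s' : agree N s s' -> agree N s' s.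
Proof. by move=> ss v vN; rewrite ss. Qed.

Lemma agree_trans N s s' s'' : agree N s s' -> agree N s' s'' -> agree N s s''.
Proof. by move=> a b v vN; rewrite a // b. Qed.

Lemma agree_set N s s' v m : agree N s s' -> agree N s.[v <- m] s'.[v <- m].
Proof. by move=> ss u uN; rewrite !fnd_set ss. Qed.

Lemma agree_fresh N s m : agree N s.[N <- m] s.
Proof. by move=> v vN; rewrite fnd_set ltn_eqF. Qed.

Lemma value_agree N s s' t m : agree N s s' -> term_bound t <= N ->
  value s t m -> value s' t m.
Proof.
move=> ss; elim: t m => [v|f ts IH] m /= bt; first by rewrite ss.
move=> [a [Ha <-]]; exists a; split=> // i; apply: IH => //.
by apply: leq_trans _ bt; apply: (leq_bigmax i).
Qed.

Lemma sat_literal_agree N s s' l : agree N s s' -> literal_bound l <= N ->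
  sat_literal s l -> sat_literal s' l.
Proof.
move=> ss; case: l => [r ts|r ts|t u|t u] /= b.
- move=> [a [Ha ra]]; exists a; split=> // i; apply: (value_agree ss _ (Ha i)).
  by apply: leq_trans _ b; apply: (leq_bigmax i).
- move=> [a [Ha ra]]; exists a; split=> // i; apply: (value_agree ss _ (Ha i)).
  by apply: leq_trans _ b; apply: (leq_bigmax i).
- move: b; rewrite geq_max => /andP[bt bu] [x [y [Hx [Hy xy]]]].
  by exists x, y; do !split=> //; [apply: value_agree ss _ Hx|apply: value_agree ss _ Hy].
- move: b; rewrite geq_max => /andP[bt bu] [x [y [Hx [Hy xy]]]].
  by exists x, y; do !split=> //; [apply: value_agree ss _ Hx|apply: value_agree ss _ Hy].
Qed.

Definition team_agree N (X X' : team M) :=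
  (forall s, X s -> exists2 s', X' s' & agree N s s') /\
  (forall s', X' s' -> exists2 s, X s & agree N s s').

Lemma team_agree_sym N X X' : team_agree N X X' -> team_agree N X' X.
Proof.
by move=> [A B]; split=> s /[dup] _; [move/B|move/A] => -[s' ? /agree_sym];
  exists s'.
Qed.

Lemma team_agree_fresh N X : team_agree N (supplement X (fun=> setT) N) X.
Proof.
split=> [_ [s [m [Xs [_ ->]]]]|s Xs].
  by exists s => //; apply: agree_fresh.
have [m _] := two_elements M.
by exists s.[N <- m]; [exists s, m|apply: agree_fresh].
Qed.

Lemma team_agree_all N X X' v : team_agree N X X' ->
  team_agree N (supplement X (fun=> setT) v) (supplement X' (fun=> setT) v).
Proof.
move=> [A B]; split=> _ [s [m [Xs [_ ->]]]].
  have [s' Xs' ss] := A s Xs; exists s'.[v <- m]; last exact: agree_set.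
  by exists s', m.
have [s' Xs' ss] := B s Xs; exists s'.[v <- m]; last exact: agree_set.
by exists s', m.
Qed.

(** Locality. One implication suffices because [team_agree] is symmetric, which is also what the
    case of [Sim] uses. *)
Lemma sat_agree_sub N (phi : formula sg) : var_bound phi <= N ->
  forall X X', team_agree N X X' -> sat X phi -> sat X' phi.
Proof.
elim: phi => [l|D x|phi IHp|phi IHp psi IHq|phi IHp psi IHq|v phi IHp|v phi IHp] /=;
  rewrite ?geq_max.
- move=> bl X X' [_ A] HX s' /A[s /HX Hs ss].
  exact: (sat_literal_agree ss bl Hs).
- move=> bx X X' [A B]; suff -> : team_rel X x = team_rel X' x by [].
  have lt_x i : x i < N.
    by apply: leq_trans _ bx; apply: (leq_bigmax (F := fun i => (x i).+1) i).
  apply: eq_set => a; apply: propext; split=> -[s Xs sa].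
    have [s' Xs' ss] := A s Xs; exists s' => // i.
    by rewrite -ss ?sa.
  have [s' Xs' ss] := B s Xs; exists s' => // i.
  by rewrite ss ?sa.
- by move=> /IHp IH X X' /team_agree_sym XX nX /(IH _ _ XX).
- by move=> /andP[/IHp Hp /IHq Hq] X X' XX [/(Hp _ _ XX) ? /(Hq _ _ XX)].
- move=> /andP[/IHp Hp /IHq Hq] X X' [A B] [Y [Z [XE [HY HZ]]]].
  exists [set s' | X' s' /\ exists2 s, Y s & agree N s s'].
  exists [set s' | X' s' /\ exists2 s, Z s & agree N s s'].
  split; [|split].
  + apply/seteqP; split=> [s' Xs'|s' [[]|[]]] //.
    have [s] := B _ Xs'; rewrite XE => -[Ys|Zs] ss.
      by left; split=> //; exists s.
    by right; split=> //; exists s.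
  + apply: Hp HY; split=> [s Ys|s' [_ ?]] //.
    have [|s' Xs' ss] := A s; first by rewrite XE; left.
    by exists s' => //; split=> //; exists s.
  + apply: Hq HZ; split=> [s Zs|s' [_ ?]] //.
    have [|s' Xs' ss] := A s; first by rewrite XE; right.
    by exists s' => //; split=> //; exists s.
- move=> /andP[vN /IHp Hp] X X' [A B] [H [H0 HX]].
  (* Several members of [X] may agree with the same [s']; choice functions being set-valued, [s']
     takes the values chosen at all of them. *)
  exists (fun s' => [set m | exists s, [/\ X s, agree N s s' & H s m]]); split.
    move=> s' /B[s Xs ss]; have [m Hm] := H0 s Xs.
    by exists m, s.
  apply: Hp HX; split=> [_ [s [m [Xs [Hm ->]]]]|_ [s' [m [Xs' [[s [Xs ss Hm]] ->]]]]].
    have [s' Xs' ss] := A s Xs; exists s'.[v <- m]; last exact: agree_set.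
    by exists s', m; do !split=> //; exists s.
  by exists s.[v <- m]; [exists s, m|apply: agree_set].
- move=> /andP[vN /IHp Hp] X X' XX; apply: Hp; exact: team_agree_all.
Qed.

(** * Flatness of first-order formulas *)

Fixpoint holds s (phi : formula sg) : Prop :=
  match phi with
  | Lit l => sat_literal s l
  | Dep _ _ | Sim _ => False
  | And p q => holds s p /\ holds s q
  | Or p q => holds s p \/ holds s q
  | Ex v p => exists m, holds s.[v <- m] p
  | All v p => forall m, holds s.[v <- m] p
  end.

(** Since splits may overlap and choice functions are set-valued, each disjunct can receive every
    assignment satisfying it, and each existential quantifier every witness. *)
Lemma first_order_flat (phi : formula sg) (X : team M) : first_order phi ->
  sat X phi <-> (forall s, X s -> holds s phi).
Proof.
rewrite /first_order.
elim: phi X => [l|D x|//|phi IHp psi IHq|phi IHp psi IHq|v phi IHp|v phi IHp] X //=.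
- move=> [/IHp Hp /IHq Hq]; rewrite Hp Hq; split=> [[A B] s Xs|A].
    by split; [apply: A|apply: B].
  by split=> s /A[].
- move=> [/IHp Hp /IHq Hq]; split=> [[Y [Z [-> [/Hp A /Hq B]]]] s|A].
    by case=> [/A|/B]; [left|right].
  exists [set s | X s /\ holds s phi], [set s | X s /\ holds s psi].
  split; last by rewrite Hp Hq; split=> s [].
  apply/seteqP; split=> [s Xs|s [[]|[]]] //.
  by case: (A s Xs); [left|right].
- move=> /IHp Hp; split=> [[H [H0 /Hp A]] s Xs|A].
    have [m Hm] := H0 s Xs; exists m; apply: A.
    by exists s, m.
  exists (fun s => [set m | holds s.[v <- m] phi]); split=> //.
  by apply/Hp => _ [s [m [_ [? ->]]]].
- move=> /IHp ->; split=> A; first by move=> s Xs m; apply: A; exists s, m.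
  by move=> _ [s [m [Xs [_ ->]]]]; apply: A.
Qed.

End Terms.

(** * Expansions by constants *)

Definition with_constants (sg : signature) : signature :=
  @Signature (Defs.fsym sg + nat)%type (rsym sg)
    (fun f => match f with inl f => farity f | inr _ => 0 end) (@rarity sg).

Definition expand sg (M : model sg) (c : nat -> M) : model (with_constants sg) :=
  @Model (with_constants sg) M
    (fun f => match f return
                 ('I_(@farity (with_constants sg) f) -> M) -> M with
              | inl f => @finterp sg M f
              | inr i => fun=> c i
              end)
    (@rinterp sg M) (two_elements M).

Definition cst sg (i : nat) : term (with_constants sg) :=
  @App (with_constants sg) (inr i) (fun=> @Var _ 0).

Section Lift.
Variable sg : signature.
Let sgc := with_constants sg.

Fixpoint lift_term (t : term sg) : term sgc :=
  match t with
  | Var v => @Var sgc v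
  | App f ts => @App sgc (inl f) (fun i => lift_term (ts i))
  end.

Definition lift_literal (l : literal sg) : literal sgc :=
  match l with
  | Rel r ts => @Rel sgc r (fun i => lift_term (ts i))
  | NRel r ts => @NRel sgc r (fun i => lift_term (ts i))
  | Eq t u => Eq (lift_term t) (lift_term u)
  | NEq t u => NEq (lift_term t) (lift_term u)
  end.

Fixpoint lift (phi : formula sg) : formula sgc :=
  match phi with
  | Lit l => Lit (lift_literal l)
  | Dep D x => @Dep sgc D x
  | Sim p => Sim (lift p)
  | And p q => And (lift p) (lift q)
  | Or p q => Or (lift p) (lift q)
  | Ex v p => Ex v (lift p)
  | All v p => All v (lift p)
  end.

Lemma lift_term_var t v : term_var (lift_term t) v <-> term_var t v.
Proof.
by elim: t => [u|f ts IH] //=; split=> -[i /IH Hi]; exists i.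
Qed.

Lemma lift_literal_var l v : literal_var (lift_literal l) v <-> literal_var l v.
Proof.
by case: l => [r ts|r ts|t u|t u] /=; rewrite ?lift_term_var //;
  split=> -[i /lift_term_var Hi]; exists i.
Qed.

Lemma free_lift phi v : free (lift phi) v <-> free phi v.
Proof.
elim: phi => [l|D x|phi IHp|phi IHp psi IHq|phi IHp psi IHq|u phi IHp
  |u phi IHp] //=;
  rewrite ?IHp ?IHq //.
exact: lift_literal_var.
Qed.

Lemma FO_sim0_lift F phi : FO_sim0 F phi -> FO_sim0 F (lift phi).
Proof.
elim: phi => [l|D x|phi IHp|phi IHp psi IHq|phi IHp psi IHq|u phi IHp
  |u phi IHp] //=.
- by case: phi {IHp}.
- by move=> [/IHp ? /IHq].
- by move=> [/IHp ? /IHq].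
Qed.

Lemma sim_lits_lift phi : sim_lits (lift phi) = sim_lits phi.
Proof.
by elim: phi => [l|D x|phi IHp|phi IHp psi IHq|phi IHp psi IHq|u phi IHp
  |u phi IHp] //=;
  rewrite ?IHp ?IHq //; case: phi {IHp}.
Qed.

Section LiftSat.
Variables (M : model sg) (c : nat -> M).
Let Mc : model sgc := expand c.

Lemma value_lift (s : assignment M) t m :
  @value sgc Mc s (lift_term t) m <-> value s t m.
Proof.
elim: t m => [u|f ts IH] m //=.
by split=> -[a [Ha <-]]; exists a; split=> // i; apply/IH.
Qed.

Lemma sat_lift_literal (s : assignment M) l :
  @sat_literal sgc Mc s (lift_literal l) <-> sat_literal s l.
Proof.
case: l => [r ts|r ts|t u|t u] /=.
- by split=> -[a [Ha ra]]; exists a; split=> // i; apply/value_lift.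
- by split=> -[a [Ha ra]]; exists a; split=> // i; apply/value_lift.
- by split=> -[a [b [/value_lift Ha [/value_lift Hb ab]]]]; exists a, b.
- by split=> -[a [b [/value_lift Ha [/value_lift Hb ab]]]]; exists a, b.
Qed.

Lemma sat_lift phi (X : team M) : @sat sgc Mc X (lift phi) <-> sat X phi.
Proof.
elim: phi X => [l|D x|phi IHp|phi IHp psi IHq|phi IHp psi IHq|u phi IHp
  |u phi IHp] X //=.
- by split=> A s /A /sat_lift_literal.
- by rewrite IHp.
- by rewrite IHp IHq.
- by split=> -[Y [Z [-> [/IHp HY /IHq HZ]]]]; exists Y, Z.
- by split=> -[H [H0 /IHp HH]]; exists H.
Qed.

End LiftSat.

(** * Elimination of one negated literal *)

(* [off_track N e g] says of an assignment: it differs on some variable below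
   [N] from the assignment [v |-> c (e v)], or else it satisfies [g]. *)
Definition off_track N (e : nat -> option nat) (g : formula sgc) : formula sgc :=
  foldr (fun v h => if e v is Some i then Or (Lit (NEq (@Var sgc v) (cst sg i))) h
                    else h) g (iota 0 N).

(** [e] sends each variable of the current domain to the index of the constant naming its tracked
    value. Quantifying [v] calls for [record]; [forget] serves the guard of an existential
    quantifier, which is read after the old value of [v] has been overwritten. *)
Definition forget v (e : nat -> option nat) : nat -> option nat :=
  fun u => if u == v then None else e u.
Definition record v d (e : nat -> option nat) : nat -> option nat :=
  fun u => if u == v then Some d else e u.

(* [witness N e d phi] replaces the leftmost negated literal of [phi] by the
   requirement that the current assignment [v |-> c (e v)], which is kept in
   the team all the way down to that literal, satisfies the negation of the
   literal. The fresh variable [N] doubles the team: the copies of the current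
   assignment with [N = c 0] are forced to the side that leads to the literal
   (resp. to take the value [c d]), the others are left free. Constants from [d]
   on are unused so far. *)
Fixpoint witness N (e : nat -> option nat) d (phi : formula sg) : formula sgc :=
  match phi with
  | Sim (Lit l) => off_track N e (Lit (lift_literal (negate_literal l)))
  | And p q => if 0 < sim_lits p then And (witness N e d p) (lift q)
               else And (lift p) (witness N e d q)
  | Or p q =>
      let g := off_track N e (Lit (NEq (@Var sgc N) (cst sg 0))) in
      if 0 < sim_lits p then All N (Or (witness N e d p) (And (lift q) g))
      else All N (Or (And (lift p) g) (witness N e d q))
  | Ex v p =>
      All N (Ex v (And (off_track N (forget v e)
                          (Or (Lit (NEq (@Var sgc N) (cst sg 0)))
                              (Lit (Eq (@Var sgc v) (cst sg d)))))
                       (witness N (record v d e) d.+1 p)))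
  | All v p => All v (witness N (record v d e) d.+1 p)
  | _ => lift phi
  end.

Lemma sim_lits_off_track N e g : sim_lits (off_track N e g) = sim_lits g.
Proof. by rewrite /off_track; elim: iota => //= v r IH; case: (e v). Qed.

Lemma FO_off_track F N e g : FO F g -> FO F (off_track N e g).
Proof. by rewrite /off_track; elim: iota => //= v r IH; case: (e v) => //=; auto. Qed.

Lemma FO_sim0_off_track F N e g : FO_sim0 F g -> FO_sim0 F (off_track N e g).
Proof. by rewrite /off_track; elim: iota => //= v r IH; case: (e v) => //=; auto. Qed.

Lemma free_off_track N e g v : free (off_track N e g) v ->
  e v <> None \/ free g v.
Proof.
rewrite /off_track; elim: iota => [|u r IH] /=; first by right.
case eu: (e u) => [i|] //= -[[->|[[]]]|] //.
by left; rewrite eu.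
Qed.

Lemma sim_lits_witness N e d phi : 0 < sim_lits phi ->
  sim_lits (witness N e d phi) = (sim_lits phi).-1.
Proof.
elim: phi e d => [l|D x|phi IHp|phi IHp psi IHq|phi IHp psi IHq|u phi IHp
  |u phi IHp] e d //=.
- by case: phi {IHp} => // l _; rewrite sim_lits_off_track.
- case: (ltnP 0 (sim_lits phi)) => [sp _|]; first by rewrite /= IHp // sim_lits_lift; case: sim_lits sp.
  by rewrite leqn0 => /eqP sp; rewrite sp /= => sq; rewrite sim_lits_lift sp IHq.
- case: (ltnP 0 (sim_lits phi)) => [sp _|].
    by rewrite /= IHp // sim_lits_lift sim_lits_off_track addn0; case: sim_lits sp.
  rewrite leqn0 => /eqP sp; rewrite sp /= => sq.
  by rewrite sim_lits_lift sim_lits_off_track sp IHq.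
- by move=> sp; rewrite sim_lits_off_track IHp.
- exact: IHp.
Qed.

Lemma FO_sim0_witness F N e d phi : FO_sim0 F phi ->
  FO_sim0 F (witness N e d phi).
Proof.
elim: phi e d => [l|D x|phi IHp|phi IHp psi IHq|phi IHp psi IHq|u phi IHp
  |u phi IHp] e d //=.
- by case: phi {IHp} => // l _; apply: FO_sim0_off_track.
- by move=> [Fp Fq]; case: ifP => _ /=; split; auto using FO_sim0_lift.
- move=> [Fp Fq]; case: ifP => _ /=; do !split; auto using FO_sim0_lift;
  exact: FO_sim0_off_track.
- by move=> Fp; split; [apply: FO_sim0_off_track|apply: IHp].
- exact: IHp.
Qed.

Lemma negate_literal_var (l : literal sg) v :
  literal_var (negate_literal l) v <-> literal_var l v.
Proof. by case: l. Qed.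

(** [N] and the variable of an existential guard are bound in front of that guard, whose other
    variables are recorded in [e]. With [e] nowhere defined, sentences stay sentences. *)
Lemma free_witness N e d phi v : free (witness N e d phi) v ->
  free phi v \/ e v <> None.
Proof.
elim: phi e d => [l|D x|phi IHp|phi IHp psi IHq|phi IHp psi IHq|u phi IHp
  |u phi IHp] e d /=.
- by move/lift_literal_var; left.
- by left.
- move: (free_lift (Sim phi) v).
  case: phi {IHp} => [l|D x|phi|phi psi|phi psi|u phi|u phi] /= E;
    try by move/E; left.
  by move/free_off_track => [?|/lift_literal_var/negate_literal_var]; [right|left].
- case: (0 < sim_lits phi) => /=; rewrite free_lift.
    by move=> [/IHp|]; tauto.
  by move=> [|/IHq]; tauto.
- case: (0 < sim_lits phi) => /= -[vN]; rewrite ?free_lift.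
    move=> [/IHp|[|/free_off_track[|[|[[]]]]]] //; tauto.
  move=> [[|/free_off_track[|[|[[]]]]]|/IHq] //; tauto.
- move=> [vN [vu [/free_off_track|/IHp]]]; last first.
    by rewrite /record; case: eqP => //; tauto.
  rewrite /forget; case: eqP => // _ [|]; first by right.
  by move=> [[|[[]]]|[|[[]]]].
- by move=> [vu /IHp]; rewrite /record; case: eqP => //; tauto.
Qed.

End Lift.

(** * Soundness and completeness of the elimination step *)

Section Witness.
Variables (sg : signature) (M : model sg) (N : nat).
Let sgc := with_constants sg.
Implicit Types (c : nat -> M) (e : nat -> option nat) (s : assignment M).
Implicit Types (X Y Z : team M).

Definition tracks c e s :=
  forall v i, v < N -> e v = Some i -> s.[? v] = Some (c i).

Definition has_dom e s := forall v, v < N -> isSome s.[? v] = isSome (e v).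

Lemma value_cst c s i m : @value sgc (expand c) s (cst sg i) m <-> c i = m.
Proof.
split=> [[a [_ <-]] //|<-].
by exists (fun=> c i); split=> // -[].
Qed.

Lemma holds_neq_cst c s v i : @holds sgc (expand c) s
    (Lit (NEq (@Var sgc v) (cst sg i))) <->
  s.[? v] <> None /\ s.[? v] <> Some (c i).
Proof.
split=> /= [[a [b [-> [/value_cst <- ac]]]]|[]].
  by split=> // -[].
case sv: s.[? v] => [a|//] _ ac; exists a, (c i); split=> //; split.
  exact/value_cst.
by move=> eac; apply: ac; rewrite eac.
Qed.

Lemma holds_eq_cst c s v i : @holds sgc (expand c) s
    (Lit (Eq (@Var sgc v) (cst sg i))) <-> s.[? v] = Some (c i).
Proof.
split=> /= [[a [b [-> [/value_cst <- ->]]]] //|sv].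
by exists (c i), (c i); do !split=> //; apply/value_cst.
Qed.

(** The guard is the implication from [tracks] to [g] in negation normal form. An undefined variable
    would refute [tracks] without satisfying the corresponding inequality, hence the condition on
    [s]. *)
Lemma holds_off_track c e s g :
  (forall v i, v < N -> e v = Some i -> s.[? v] <> None) ->
  @holds sgc (expand c) s (off_track N e g) <->
  (tracks c e s -> @holds sgc (expand c) s g).
Proof.
move=> De; have -> : tracks c e s =
    (forall v i, v \in iota 0 N -> e v = Some i -> s.[? v] = Some (c i)).
  by apply: propext; split=> T v i vN; apply: T; rewrite mem_iota in vN *.
have {}De v i : v \in iota 0 N -> e v = Some i -> s.[? v] <> None.
  by rewrite mem_iota => /De; apply.
rewrite /off_track; elim: iota De => [|u r IH] De.
  by split=> [Hg _ //|]; apply.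
have {IH} IH := IH (fun v i vr => De v i (mem_behead (s := u :: r) vr)).
rewrite /=; case eu: (e u) => [i|]; last first.
  rewrite IH; split=> A B; apply: A => v i.
    by move=> vr; apply: B; rewrite inE vr orbT.
  by rewrite inE => /orP[/eqP ->|vr]; [rewrite eu|apply: B].
have Du := De u i (mem_head _ _) eu.
split=> [[/(holds_neq_cst c s u i)[_ nu]|/IH A] B|A].
- by case: nu; apply: B => //; apply: mem_head.
- by apply: A => v j vr; apply: B; rewrite inE vr orbT.
- have [su|nu] := pselect (s.[? u] = Some (c i)).
    right; apply/IH => B; apply: A => v j; rewrite inE => /orP[/eqP ->|vr].
      by rewrite eu => -[<-].
    exact: B.
  by left; apply/holds_neq_cst.
Qed.

Lemma has_dom_agree e s s' : agree N s s' -> has_dom e s -> has_dom e s'.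
Proof. by move=> ss D v vN; rewrite -ss // D. Qed.

Lemma tracks_agree c e s s' : agree N s s' -> tracks c e s -> tracks c e s'.
Proof. by move=> ss D v i vN ev; rewrite -ss //; apply: D. Qed.

(** The constants fix the variables recorded in [e], and [has_dom] leaves all others below [N]
    undefined. *)
Lemma tracks_uniq c e s s' : has_dom e s -> has_dom e s' ->
  tracks c e s -> tracks c e s' -> agree N s s'.
Proof.
move=> Ds Ds' Ts Ts' v vN.
case ev: (e v) => [i|]; first by rewrite (Ts v i) // (Ts' v i).
by move: (Ds v vN) (Ds' v vN); rewrite ev; do 2!case: fnd.
Qed.

Lemma has_dom_set e s v d m : has_dom e s -> has_dom (record v d e) s.[v <- m].
Proof. by move=> D u uN; rewrite fnd_set /record; case: eqP => // _; apply: D. Qed.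

Lemma has_dom_value e s v i : has_dom e s -> v < N -> e v = Some i ->
  s.[? v] <> None.
Proof. by move=> D vN ev; move: (D v vN); rewrite ev; case: fnd. Qed.

Lemma forget_value e s v u i m : has_dom e s -> u < N -> forget v e u = Some i ->
  s.[v <- m].[? u] <> None.
Proof.
move=> D uN; rewrite /forget fnd_set; case: eqP => // _; exact: has_dom_value.
Qed.

Lemma tracks_set c e s v d : tracks c e s ->
  tracks c (record v d e) s.[v <- c d].
Proof.
move=> T u i uN; rewrite /record fnd_set; case: eqP => [_ [<-] //|_].
exact: T.
Qed.

Lemma has_dom_fresh e s m : has_dom e s -> has_dom e s.[N <- m].
Proof. by apply: has_dom_agree; apply/agree_sym/agree_fresh. Qed.

Lemma tracks_fresh c e s m : tracks c e s -> tracks c e s.[N <- m].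
Proof. by apply: tracks_agree; apply/agree_sym/agree_fresh. Qed.

(** By induction the tracked assignment, or a copy of it, survives in the team down to the negated
    literal, where the guard makes it falsify the literal. *)
Lemma witness_sound c e d phi X s0 :
  var_bound phi <= N -> 0 < sim_lits phi ->
  (forall s, X s -> has_dom e s) -> X s0 -> tracks c e s0 ->
  @sat sgc (expand c) X (witness N e d phi) -> sat X phi.
Proof.
elim: phi e d X s0 => [l|D x|phi IHp|phi IHp psi IHq|phi IHp psi IHq|v phi IHp|v phi IHp]
  e d X s0 //=; rewrite ?geq_max.
- case: phi {IHp} => // l _ _ HD X0 T0.
  rewrite first_order_flat; last exact: FO_off_track.
  move=> /(_ _ X0) /holds_off_track A /(_ _ X0).
  apply: sat_negate_literal; apply/(sat_lift_literal c); apply: A => //.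
  by move=> v i; apply: has_dom_value; apply: HD.
- move=> /andP[bp bq] spq HD X0 T0.
  case: (ltnP 0 (sim_lits phi)) => [sp|]; last first.
    rewrite leqn0 => /eqP sp; move: spq; rewrite sp => sq.
    by move=> [/sat_lift ? HX]; split=> //; apply: (IHq e d X s0).
  by move=> [HX /sat_lift ?]; split=> //; apply: (IHp e d X s0).
- move=> /andP[bp bq] spq HD X0 T0 HX.
  have bpq : var_bound (Or phi psi) <= N by rewrite /= geq_max bp.
  (* By locality the doubled team may replace [X]; the copy of [s0] with [N] set to [c 0] is tracked
     from here on. *)
  apply: (sat_agree_sub bpq (team_agree_fresh N X)).
  have X0' : supplement X (fun=> setT) N s0.[N <- c 0] by exists s0, (c 0).
  have HD' s : supplement X (fun=> setT) N s -> has_dom e s.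
    by move=> [s' [m [Xs [_ ->]]]]; apply/has_dom_fresh/HD.
  have T0' := tracks_fresh (c 0) T0.
  (* A part of the split that satisfies the guard misses the tracked copy, which must then lie in
     the other part, where the induction hypothesis applies. *)
  have off (Z : team M) : @sat sgc (expand c) Z
      (off_track N e (Lit (NEq (@Var sgc N) (cst sg 0)))) -> ~ Z s0.[N <- c 0].
    rewrite first_order_flat; last exact: FO_off_track.
    move=> A /A /holds_off_track B.
    have /holds_neq_cst : @holds sgc (expand c) s0.[N <- c 0]
        (Lit (NEq (@Var sgc N) (cst sg 0))).
      by apply: B => // v i; apply: has_dom_value; apply: HD'.
    by rewrite fnd_set eqxx => -[].
  move: HX; case: (ltnP 0 (sim_lits phi)) => [sp|] /=.
    move=> [Y [Z [XE [HY [/sat_lift HZ /off gZ]]]]]; exists Y, Z.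
    have {}XE : supplement X (fun=> setT) N = Y `|` Z := XE.
    rewrite XE in X0' HD'; split=> //; split=> //.
    case: X0' => // Y0; apply: (IHp e d Y _ bp sp _ Y0 T0' HY).
    by move=> s Ys; apply: HD'; left.
  rewrite leqn0 => /eqP sp; move: spq; rewrite sp => sq.
  move=> [Z [Y [XE [[/sat_lift HZ /off gZ] HY]]]]; exists Z, Y.
  have {}XE : supplement X (fun=> setT) N = Z `|` Y := XE.
  rewrite XE in X0' HD'; split=> //; split=> //.
  case: X0' => // Y0; apply: (IHq e d Y _ bq sq _ Y0 T0' HY).
  by move=> s Ys; apply: HD'; right.
- move=> /andP[vN bp] sp HD X0 T0 [H [H0 [G HX]]].
  have bvp : var_bound (Ex v phi) <= N by rewrite /= geq_max vN.
  apply: (sat_agree_sub bvp (team_agree_fresh N X)).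
  exists H; split=> //.
  have X0' : supplement X (fun=> setT) N s0.[N <- c 0] by exists s0, (c 0).
  have HD' s : supplement X (fun=> setT) N s -> has_dom e s.
    by move=> [s' [m [Xs [_ ->]]]]; apply/has_dom_fresh/HD.
  have T0' := tracks_fresh (c 0) T0.
  have [m Hm] := H0 _ X0'.
  have Xm : supplement (supplement X (fun=> setT) N) H v s0.[N <- c 0].[v <- m].
    by exists s0.[N <- c 0], m.
  (* On the tracked copy the inequality in the guard fails, so only the named value can have been
     chosen. *)
  have em : m = c d.
    move: G; rewrite first_order_flat; last exact: FO_off_track.
    move=> /(_ _ Xm) /holds_off_track G.
    have : @holds sgc (expand c) s0.[N <- c 0].[v <- m]
      (Or (Lit (NEq (@Var sgc N) (cst sg 0))) (Lit (Eq (@Var sgc v) (cst sg d)))).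
      apply: G => u i uN; first by apply: forget_value => //; apply: HD'.
      rewrite /forget fnd_set; case: eqP => // _; exact: T0'.
    move=> [/holds_neq_cst|/holds_eq_cst].
      by rewrite !fnd_set (gtn_eqF vN) eqxx => -[].
    by rewrite fnd_set eqxx => -[].
  rewrite em in Xm.
  apply: (IHp (record v d e) d.+1 _ _ bp sp _ Xm _ HX).
    by move=> _ [s [a [Xs [_ ->]]]]; apply/has_dom_set/HD'.
  exact: tracks_set.
- move=> /andP[vN bp] sp HD X0 T0 HX.
  (* A universal quantifier supplies every value, in particular the named one, so the tracked
     assignment survives unguarded. *)
  have Xm : supplement X (fun=> setT) v s0.[v <- c d] by exists s0, (c d).
  apply: (IHp (record v d e) d.+1 _ _ bp sp _ Xm _ HX).
    by move=> _ [s [a [Xs [_ ->]]]]; apply/has_dom_set/HD.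
  exact: tracks_set.
Qed.


(* The value of the tracked assignment at a quantifier is only known once the
   rest of the formula has been evaluated, hence the quantifier order: [s0] is
   found first, and the constants from [d] on are chosen afterwards. *)
Lemma witness_complete phi X :
  var_bound phi <= N -> 0 < sim_lits phi -> sat X phi ->
  exists2 s0, X s0 & forall c e d X', team_agree N X X' ->
    (forall s, X' s -> has_dom e s) ->
    (forall v, free phi v -> e v <> None) ->
    (forall v i, e v = Some i -> i < d) -> 0 < d -> tracks c e s0 ->
    exists2 c', forall i, i < d -> c' i = c i &
      @sat sgc (expand c') X' (witness N e d phi).
Proof.
elim: phi X => [l|D x|phi IHp|phi IHp psi IHq|phi IHp psi IHq|v phi IHp|v phi IHp]
  X //=; rewrite ?geq_max.
- case: phi {IHp} => //= l bl _ /existsNP[s0 /not_implyP[X0 nl]].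
  exists s0 => // c e d X' [XX XX'] HD Hf _ _ T0; exists c => //.
  rewrite first_order_flat; last exact: FO_off_track.
  move=> s' Xs'; apply/holds_off_track.
    by move=> v i; apply: has_dom_value; apply: HD.
  move=> T'; apply/(sat_lift_literal c).
  have [s0' Xs0' ss0] := XX _ X0.
  (* A tracking member of [X'] agrees with [s0] below [N], and so it falsifies [l] too. *)
  have ss : @agree sg M N s' s0.
    apply: agree_trans (agree_sym ss0).
    apply: (tracks_uniq (HD _ Xs') (HD _ Xs0') T').
    exact: tracks_agree ss0 T0.
  apply: negate_literal_sat => [v /= lv|].
    have := Hf v lv; case ev: (e v) => [i|] // _.
    by apply: (has_dom_value (HD _ Xs')) ev; apply: (literal_var_bound bl lv).
  by move=> /(sat_literal_agree ss bl).
- move=> /andP[bp bq] spq [Sp Sq].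
  case: (ltnP 0 (sim_lits phi)) => [sp|]; last first.
    rewrite leqn0 => /eqP sp; move: spq; rewrite sp => sq.
    have [s0 X0 IH] := IHq X bq sq Sq; exists s0 => // c e d X' XX HD Hf He d0 T0.
    have [|c' cc Sc] := IH c e d X' XX HD _ He d0 T0; first by auto.
    exists c' => //=; split=> //; apply/sat_lift.
    exact: (sat_agree_sub bp XX).
  have [s0 X0 IH] := IHp X bp sp Sp; exists s0 => // c e d X' XX HD Hf He d0 T0.
  have [|c' cc Sc] := IH c e d X' XX HD _ He d0 T0; first by auto.
  exists c' => //=; split=> //; apply/sat_lift.
  exact: (sat_agree_sub bq XX).
- move=> /andP[bp bq] spq [Y [Z [XE [SY SZ]]]].
  (* The doubled team is split as follows: the side leading to the literal receives all copies of
     its part ([up]), the other side only the copies of its part that are not tracked with [N] equal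
     to [c 0] ([off]). *)
  pose up X' (W : team M) : team M := [set s' | supplement X' (fun=> setT) N s' /\
    exists2 s, W s & agree N s s'].
  pose off c e X' W : team M := [set s' | up X' W s' /\
    (tracks c e s' -> s'.[? N] <> Some (c 0))].
  have upP X' W : team_agree N X X' -> W `<=` X -> team_agree N W (up X' W).
    move=> [A _] WX; split=> [s Ws|s' [_ ?]] //.
    have [s' Xs' ss] := A _ (WX _ Ws); have [m _] := two_elements M.
    have ss' : agree N s s'.[N <- m].
      exact: agree_trans ss (agree_sym (agree_fresh _ _)).
    by exists s'.[N <- m] => //; split; [exists s', m|exists s].
  have offP c e X' W : team_agree N X X' -> W `<=` X ->
      team_agree N W (off c e X' W).
    move=> [A _] WX; split=> [s Ws|s' [[_ ?] _]] //.
    have [s' Xs' ss] := A _ (WX _ Ws).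
    (* A second element of the domain gives every assignment a copy that is not excluded, so [off]
       loses nothing below [N]. *)
    have [m m0] : exists m : M, m <> c 0.
      have [a [b ab]] := two_elements M.
      by have [<-|] := pselect (a = c 0); [exists b => /esym|exists a].
    have ss' : agree N s s'.[N <- m].
      exact: agree_trans ss (agree_sym (agree_fresh _ _)).
    exists s'.[N <- m] => //; split; first by split; [exists s', m|exists s].
    by move=> _; rewrite fnd_set eqxx => -[].
  have up_dom e X' W s : (forall s, X' s -> has_dom e s) -> up X' W s -> has_dom e s.
    by move=> HD [[s' [m [/HD Ds [_ ->]]]] _]; apply: has_dom_fresh.
  have off_sat c e X' W : (forall s, X' s -> has_dom e s) ->
      @sat sgc (expand c) (off c e X' W)
        (off_track N e (Lit (NEq (@Var sgc N) (cst sg 0)))).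
    move=> HD; rewrite first_order_flat; last exact: FO_off_track.
    move=> s [Ws Ts]; have Ds := up_dom _ _ _ _ HD Ws.
    apply/holds_off_track; first by move=> v i; apply: has_dom_value.
    move=> /Ts sN; apply/holds_neq_cst; split=> //.
    by case: Ws => -[s' [m [_ [_ ->]]]] _; rewrite fnd_set eqxx.
  (* What [off] excludes is tracked, hence agrees with [s0], which lies in [W]; so [up] contains
     it. *)
  have cover c e X' W W' s0 : team_agree N X X' -> X = W `|` W' ->
      (forall s, X' s -> has_dom e s) -> W s0 -> tracks c e s0 ->
      supplement X' (fun=> setT) N = up X' W `|` off c e X' W'.
    move=> [A B] XW HD W0 T0; apply/seteqP; split=> [s Xs|s [[]|[[]]]] //.
    have [Ws|nWs] := pselect (up X' W s); [by left|right].
    case: (Xs) => s' [m [Xs' [_ sE]]]; have [x Xx xs'] := B _ Xs'.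
    have xs : agree N x s.
      by rewrite sE; apply: agree_trans xs' (agree_sym (agree_fresh _ _)).
    split.
      split=> //; exists x => //.
      by move: Xx; rewrite XW => -[Wx|//]; case: nWs; split=> //; exists x.
    move=> Ts; case: nWs; split=> //; exists s0 => //.
    have [|s0' Xs0' ss0] := A s0; first by rewrite XW; left.
    apply: agree_trans (ss0) _; apply: (@tracks_uniq c e) => //.
    + exact: HD.
    + by rewrite sE; apply: has_dom_fresh; apply: HD.
    + exact: tracks_agree T0.
  have YX : Y `<=` X by move=> s Ys; rewrite XE; left.
  have ZX : Z `<=` X by move=> s Zs; rewrite XE; right.
  case: (ltnP 0 (sim_lits phi)) => [sp|]; last first.
    rewrite leqn0 => /eqP sp; move: spq; rewrite sp => sq.
    have [s0 Z0 IH] := IHq Z bq sq SZ; exists s0; first exact: ZX.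
    move=> c e d X' XX HD Hf He d0 T0.
    have [||c' cc Sc] := IH c e d (up X' Z) (upP _ _ XX ZX) _ _ He d0 T0.
    + by move=> s; apply: up_dom.
    + by auto.
    have T0' : tracks c' e s0.
      by move=> v i vN ev; rewrite cc; [apply: T0|apply: He ev].
    exists c' => //=; exists (off c' e X' Y), (up X' Z); split; [|split=> //].
      rewrite setUC; apply: cover XX _ HD Z0 T0'.
      by rewrite setUC.
    split; last exact: off_sat.
    by apply/sat_lift; apply: (sat_agree_sub bp (offP _ _ _ _ XX YX)).
  have [s0 Y0 IH] := IHp Y bp sp SY; exists s0; first exact: YX.
  move=> c e d X' XX HD Hf He d0 T0.
  have [||c' cc Sc] := IH c e d (up X' Y) (upP _ _ XX YX) _ _ He d0 T0.
  + by move=> s; apply: up_dom.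
  + by auto.
  have T0' : tracks c' e s0.
    by move=> v i vN ev; rewrite cc; [apply: T0|apply: He ev].
  exists c' => //=; exists (up X' Y), (off c' e X' Z); split; [|split=> //].
    exact: cover XX XE HD Y0 T0'.
  split; last exact: off_sat.
  by apply/sat_lift; apply: (sat_agree_sub bq (offP _ _ _ _ XX ZX)).
- move=> /andP[vN bp] sp [H [H0 HX]].
  (* The induction hypothesis picks an assignment of the supplemented team; its predecessor [s0] is
     the one to track, and its value [m] at [v] will be named by constant [d]. *)
  have [s1 [s0 [m [X0 [Hm ->]]]] IH] := IHp _ bp sp HX; exists s0 => //.
  move=> c e d X' [A B] HD Hf He d0 T0.
  pose c1 i := if i == d then m else c i.
  have c1E i : i < d -> c1 i = c i by move=> id; rewrite /c1 ltn_eqF.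
  have T1 : tracks c1 e s0.
    by move=> u i uN eu; rewrite c1E; [apply: T0|apply: He eu].
  (* Where [on] holds the guard forces the single value [m]; elsewhere [H'] collects the values of
     [H] at all agreeing members of [X]. *)
  pose on s := tracks c1 (forget v e) s /\ s.[? N] = Some (c1 0).
  pose H' s : set M := [set a | (on s /\ a = m) \/
    ~ on s /\ exists2 x, X x & agree N x s /\ H x a].
  have D0 : has_dom e s0.
    have [s0' Xs0' ss] := A _ X0.
    exact: has_dom_agree (agree_sym ss) (HD _ Xs0').
  have HDN s : supplement X' (fun=> setT) N s -> has_dom e s.
    by move=> [s' [a [Xs [_ ->]]]]; apply/has_dom_fresh/HD.
  have BN s : supplement X' (fun=> setT) N s -> exists2 x, X x & agree N x s.
    move=> [s' [a [Xs [_ ->]]]]; have [x Xx xs] := B _ Xs; exists x => //.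
    exact: agree_trans xs (agree_sym (agree_fresh _ _)).
  have XX' : team_agree N (supplement X H v)
      (supplement (supplement X' (fun=> setT) N) H' v).
    split=> [_ [x [a [Xx [Ha ->]]]]|_ [s [a [Xs [[[[Ts sN] ->]|[_ [x Xx [xs Ha]]]] ->]]]]].
    + have [s' Xs' ss] := A _ Xx.
      have [b b0] : exists b : M, b <> c1 0.
        have [b [b' bb]] := two_elements M.
        by have [<-|] := pselect (b = c1 0); [exists b' => /esym|exists b].
      have xs : agree N x s'.[N <- b].
        exact: agree_trans ss (agree_sym (agree_fresh _ _)).
      exists s'.[N <- b].[v <- a]; last exact: agree_set.
      exists s'.[N <- b], a; split; first by exists s', b.
      split=> //; right; split; last by exists x.
      by move=> [_]; rewrite fnd_set eqxx => -[].
    (* [on] does not constrain [v], but once [v] is overwritten by [m] the result agrees with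
       [s0.[v <- m]]. *)
    + exists s0.[v <- m]; first by exists s0, m.
      move=> u uN; rewrite !fnd_set; case: eqP => // /eqP uv.
      have := HDN _ Xs u uN; have := D0 u uN.
      case eu: (e u) => [i|]; last by do 2!case: fnd.
      by rewrite (T1 u i) // (Ts u i) // /forget (negPf uv).
    + by exists x.[v <- a]; [exists x, a|apply: agree_set].
  have [|||||c' cc Sc] := IH c1 (record v d e) d.+1 _ XX'.
  + by move=> _ [s [a [Xs [_ ->]]]]; apply/has_dom_set/HDN.
  + by move=> u fu; rewrite /record; case: eqP => // uv; apply: Hf.
  + move=> u i; rewrite /record; case: eqP => [_ [<-] //|_ /He id].
    exact: ltnW.
  + by [].
  + have -> : m = c1 d by rewrite /c1 eqxx.
    exact: tracks_set.
  have c'0 : c' 0 = c1 0 by apply: cc.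
  have c'd : c' d = m by rewrite cc // /c1 eqxx.
  exists c'; first by move=> i id; rewrite cc ?c1E // ltnW.
  exists H'; split; last split=> //.
    move=> s Xs; have [os|nos] := pselect (on s); first by exists m; left.
    have [x Xx xs] := BN _ Xs; have [a Ha] := H0 _ Xx.
    by exists a; right; split=> //; exists x.
  rewrite first_order_flat; last exact: FO_off_track.
  move=> _ [s [a [Xs [Ha ->]]]]; apply/holds_off_track.
    by move=> u i; apply: forget_value; apply: HDN.
  move=> Ts; case: Ha => [[_ ->]|[nos _]].
    by right; apply/holds_eq_cst; rewrite fnd_set eqxx c'd.
  left; apply/holds_neq_cst; rewrite fnd_set (gtn_eqF vN) c'0.
  split; first by case: Xs => s' [b [_ [_ ->]]]; rewrite fnd_set eqxx.
  move=> sN; apply: nos; split=> // u i uN fu.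
  have := Ts u i uN fu; move: fu; rewrite /forget fnd_set.
  by case: eqP => // _ /He id ->; rewrite cc // ltnW.
- move=> /andP[vN bp] sp HX.
  have [s1 [s0 [m [X0 [Hm ->]]]] IH] := IHp _ bp sp HX; exists s0 => //.
  move=> c e d X' XX HD Hf He d0 T0.
  pose c1 i := if i == d then m else c i.
  have c1E i : i < d -> c1 i = c i by move=> id; rewrite /c1 ltn_eqF.
  have T1 : tracks c1 e s0.
    by move=> u i uN eu; rewrite c1E; [apply: T0|apply: He eu].
  have [|||||c' cc Sc] := IH c1 (record v d e) d.+1 _ (team_agree_all v XX).
  + by move=> _ [s [a [Xs [_ ->]]]]; apply/has_dom_set/HD.
  + by move=> u fu; rewrite /record; case: eqP => // uv; apply: Hf.
  + move=> u i; rewrite /record; case: eqP => [_ [<-] //|_ /He id].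
    exact: ltnW.
  + by [].
  + have -> : m = c1 d by rewrite /c1 eqxx.
    exact: tracks_set.
  by exists c' => // i id; rewrite cc ?c1E // ltnW.
Qed.

End Witness.

(** * Quantifying the constants of a first-order sentence *)

Section Constants.
Variable sg : signature.
Let sgc := with_constants sg.

Fixpoint term_cst_bound (t : term sgc) : nat :=
  match t with
  | Var _ => 0
  | App f ts => maxn (if f is inr i then i.+1 else 0)
                     (\max_(i < farity f) term_cst_bound (ts i))
  end.

Definition literal_cst_bound (l : literal sgc) : nat :=
  match l with
  | Rel r ts | NRel r ts => \max_(i < rarity r) term_cst_bound (ts i)
  | Eq t u | NEq t u => maxn (term_cst_bound t) (term_cst_bound u)
  end.

Fixpoint cst_bound (phi : formula sgc) : nat :=
  match phi with
  | Lit l => literal_cst_bound l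
  | Dep _ _ => 0
  | Sim p | Ex _ p | All _ p => cst_bound p
  | And p q | Or p q => maxn (cst_bound p) (cst_bound q)
  end.

Variables B K : nat.

(** Constant [i] becomes variable [B + i], which no quantifier captures when [B] is at least the
    [var_bound] of the formula. *)
Fixpoint unlift_term (t : term sgc) : term sg :=
  match t with
  | Var v => @Var sg v
  | App (inl f) ts => @App sg f (fun i => unlift_term (ts i))
  | App (inr i) _ => @Var sg (B + i)
  end.

Definition unlift_literal (l : literal sgc) : literal sg :=
  match l with
  | Rel r ts => @Rel sg r (fun i => unlift_term (ts i))
  | NRel r ts => @NRel sg r (fun i => unlift_term (ts i))
  | Eq t u => Eq (unlift_term t) (unlift_term u)
  | NEq t u => NEq (unlift_term t) (unlift_term u)
  end.

Fixpoint unlift (phi : formula sgc) : formula sg :=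
  match phi with
  | Lit l => Lit (unlift_literal l)
  | Dep D x => @Dep sg D x
  | Sim p => Sim (unlift p)
  | And p q => And (unlift p) (unlift q)
  | Or p q => Or (unlift p) (unlift q)
  | Ex v p => Ex v (unlift p)
  | All v p => All v (unlift p)
  end.

Lemma FO_unlift F phi : FO F phi -> FO F (unlift phi).
Proof. by elim: phi => //= p IHp q IHq [/IHp ? /IHq]. Qed.

Let new v := exists2 i, i < K & v = B + i.

Lemma unlift_term_var t v : term_cst_bound t <= K ->
  term_var (unlift_term t) v -> term_var t v \/ new v.
Proof.
elim: t => [u|[f|j] ts IH] /=; first by left.
  rewrite max0n => /bigmax_leqP bt [i vi].
  by have [||] := IH i _ vi; [apply: bt|left; exists i|right].
by rewrite geq_max => /andP[jK _] ->; right; exists j.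
Qed.

Lemma unlift_literal_var l v : literal_cst_bound l <= K ->
  literal_var (unlift_literal l) v -> literal_var l v \/ new v.
Proof.
case: l => [r ts|r ts|t u|t u] /=.
- move/bigmax_leqP => bt [i /unlift_term_var [|vi|vi]]; first exact: bt.
    by left; exists i.
  by right.
- move/bigmax_leqP => bt [i /unlift_term_var [|vi|vi]]; first exact: bt.
    by left; exists i.
  by right.
- by rewrite geq_max => /andP[bt bu] [/(unlift_term_var bt)|/(unlift_term_var bu)]; tauto.
- by rewrite geq_max => /andP[bt bu] [/(unlift_term_var bt)|/(unlift_term_var bu)]; tauto.
Qed.

Lemma free_unlift phi v : cst_bound phi <= K ->
  free (unlift phi) v -> free phi v \/ new v.
Proof.
elim: phi => [l|D x|p IHp|p IHp q IHq|p IHp q IHq|u p IHp|u p IHp] /=;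
  rewrite ?geq_max.
- exact: unlift_literal_var.
- by left.
- exact: IHp.
- by move=> /andP[bp bq] [/(IHp bp)|/(IHq bq)]; tauto.
- by move=> /andP[bp bq] [/(IHp bp)|/(IHq bq)]; tauto.
- by move=> bp [? /(IHp bp)]; tauto.
- by move=> bp [? /(IHp bp)]; tauto.
Qed.

Section Semantics.
Variables (M : model sg) (c : nat -> M).
Let Mc : model sgc := expand c.

Lemma value_unlift (s s' : assignment M) t m : agree B s s' ->
  (forall i, i < K -> s'.[? B + i] = Some (c i)) ->
  term_bound t <= B -> term_cst_bound t <= K ->
  @value sgc Mc s t m <-> value s' (unlift_term t) m.
Proof.
move=> ss sc; elim: t m => [v|[f|j] ts IH] m /=; first by move=> vB _; rewrite ss.
  rewrite max0n => /bigmax_leqP bv /bigmax_leqP bc.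
  by split=> -[a [Ha <-]]; exists a; split=> // i; apply/IH => //;
    do ?[exact: bv|exact: bc].
rewrite geq_max => _ /andP[jK _]; rewrite sc //.
split=> [[a [_ <-]] //|[<-]].
by exists (fun=> c j); split=> // -[].
Qed.

Lemma sat_unlift_literal (s s' : assignment M) l : agree B s s' ->
  (forall i, i < K -> s'.[? B + i] = Some (c i)) ->
  literal_bound l <= B -> literal_cst_bound l <= K ->
  @sat_literal sgc Mc s l <-> sat_literal s' (unlift_literal l).
Proof.
move=> ss sc; case: l => [r ts|r ts|t u|t u] /=.
- move=> /bigmax_leqP bv /bigmax_leqP bc.
  have E i m := value_unlift m ss sc (bv i isT) (bc i isT).
  by split=> -[a [Ha ra]]; exists a; split=> // i; apply/E.
- move=> /bigmax_leqP bv /bigmax_leqP bc.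
  have E i m := value_unlift m ss sc (bv i isT) (bc i isT).
  by split=> -[a [Ha ra]]; exists a; split=> // i; apply/E.
- rewrite !geq_max => /andP[vt vu] /andP[ct cu].
  have Et m := value_unlift m ss sc vt ct.
  have Eu m := value_unlift m ss sc vu cu.
  by split=> -[a [b [/Et Ha [/Eu Hb ab]]]]; exists a, b.
- rewrite !geq_max => /andP[vt vu] /andP[ct cu].
  have Et m := value_unlift m ss sc vt ct.
  have Eu m := value_unlift m ss sc vu cu.
  by split=> -[a [b [/Et Ha [/Eu Hb ab]]]]; exists a, b.
Qed.

(** Quantifiers overwrite variables below [B] only, so the variables standing for constants keep
    their values throughout. *)
Lemma holds_unlift (s s' : assignment M) phi : agree B s s' ->
  (forall i, i < K -> s'.[? B + i] = Some (c i)) ->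
  var_bound phi <= B -> cst_bound phi <= K ->
  @holds sgc Mc s phi <-> holds s' (unlift phi).
Proof.
have set_cst (s1 : assignment M) v m : v < B ->
    (forall i, i < K -> s1.[? B + i] = Some (c i)) ->
    forall i, i < K -> s1.[v <- m].[? B + i] = Some (c i).
  move=> vB sc i iK; rewrite fnd_set gtn_eqF ?sc //.
  exact: leq_trans vB (leq_addr _ _).
elim: phi s s' => [l|D x|p IHp|p IHp q IHq|p IHp q IHq|v p IHp|v p IHp] s s' ss sc //=;
  rewrite ?geq_max.
- exact: sat_unlift_literal.
- by move=> /andP[vp vq] /andP[cp cq]; rewrite (IHp s s') // (IHq s s').
- by move=> /andP[vp vq] /andP[cp cq]; rewrite (IHp s s') // (IHq s s').
- move=> /andP[vB vp] cp.
  have E m := IHp _ _ (agree_set v m ss) (set_cst _ _ _ vB sc) vp cp.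
  by split=> -[m /E Hm]; exists m.
- move=> /andP[vB vp] cp.
  have E m := IHp _ _ (agree_set v m ss) (set_cst _ _ _ vB sc) vp cp.
  by split=> Hm m; apply/E.
Qed.

End Semantics.
End Constants.

Fixpoint exists_from sg B k (phi : formula sg) : formula sg :=
  if k is k'.+1 then Ex (B + k') (exists_from B k' phi) else phi.

Lemma FO_exists_from F sg B k (phi : formula sg) :
  FO F phi -> FO F (exists_from B k phi).
Proof. by elim: k. Qed.

Lemma free_exists_from sg B k (phi : formula sg) v :
  free (exists_from B k phi) v ->
  free phi v /\ forall i, i < k -> v <> B + i.
Proof.
elim: k => [|k IH] //= [vk /IH[fv vi]]; split=> // i.
by rewrite ltnS leq_eqVlt => /orP[/eqP ->|/vi].
Qed.

(** The clause on variables from [B + k] on serves the induction: it recovers the value of the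
    outermost variable, which the inner quantifiers leave alone. *)
Lemma holds_exists_from sg (M : model sg) B k (phi : formula sg)
    (s : assignment M) :
  holds s (exists_from B k phi) ->
  exists c (s' : assignment M), [/\ agree B s' s,
    forall v, B + k <= v -> s'.[? v] = s.[? v],
    forall i, i < k -> s'.[? B + i] = Some (c i) & holds s' phi].
Proof.
elim: k s => [|k IH] s /=.
  by have [a _] := two_elements M; exists (fun=> a), s.
move=> [m /IH[c [s' [sB sk sc Hs]]]].
exists (fun i => if i == k then m else c i), s'; split=> //.
- by move=> v vB; rewrite sB // fnd_set ltn_eqF // (leq_trans vB) ?leq_addr.
- move=> v; rewrite addnS => vk; rewrite sk ?fnd_set ?gtn_eqF //; exact: ltnW.
- move=> i; rewrite ltnS leq_eqVlt; case: eqP => [-> _|_ /sc //].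
  by rewrite sk // fnd_set eqxx.
Qed.

Lemma exists_from_holds sg (M : model sg) B k (phi : formula sg)
    (s : assignment M) (c : nat -> M) :
  (forall s' : assignment M, agree B s' s ->
    (forall v, B + k <= v -> s'.[? v] = s.[? v]) ->
    (forall i, i < k -> s'.[? B + i] = Some (c i)) -> holds s' phi) ->
  holds s (exists_from B k phi).
Proof.
elim: k s => [|k IH] s /= Hs; first exact: Hs.
exists (c k); apply: IH => s' sB sk sc; apply: Hs.
- by move=> v vB; rewrite sB // fnd_set ltn_eqF // (leq_trans vB) ?leq_addr.
- move=> v; rewrite addnS => vk; rewrite sk ?fnd_set ?gtn_eqF //; exact: ltnW.
- move=> i; rewrite ltnS leq_eqVlt => /orP[/eqP ->|/sc //].
  by rewrite sk // fnd_set eqxx.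
Qed.

Lemma true_in_holds sg (M : model sg) (phi : formula sg) : first_order phi ->
  true_in M phi <-> @holds sg M [fmap] phi.
Proof.
move=> Fp; rewrite /true_in first_order_flat //.
by split=> [|? _ ->] //; apply.
Qed.

(** By flatness a first-order sentence is evaluated at the empty assignment alone, so one choice of
    values for the quantified variables amounts to one interpretation of the constants. Only those
    below [cst_bound] matter. *)
Lemma quantify_constants sg (phi : formula (with_constants sg)) :
  first_order phi -> sentence phi ->
  exists psi : formula sg, [/\ first_order psi, sentence psi &
    forall M : model sg, true_in M psi <->
      exists c : nat -> M, true_in (expand c) phi].
Proof.
move=> Fp Sp; pose B := var_bound phi; pose K := cst_bound phi.
have Fu : first_order (exists_from B K (unlift B phi)).
  by apply: FO_exists_from; apply: FO_unlift.
exists (exists_from B K (unlift B phi)); split=> //.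
  move=> v /free_exists_from[/(free_unlift (leqnn K))[/Sp //|[i iK ->]]].
  by move=> /(_ i iK).
move=> M; rewrite true_in_holds //; split.
  move=> /holds_exists_from[c [s' [sB _ sc Hs]]]; exists c.
  apply/true_in_holds => //.
  exact/(holds_unlift (agree_sym sB) sc (leqnn _) (leqnn _)).
move=> [c /true_in_holds Hp]; apply: (exists_from_holds (c := c)) => s' sB _ sc.
by apply/(holds_unlift (agree_sym sB) sc (leqnn _) (leqnn _)); apply: Hp.
Qed.

(** * Induction on the number of negated literals *)

Lemma witness_correct sg (phi : formula sg) (M : model sg) :
  sentence phi -> 0 < sim_lits phi ->
  true_in M phi <-> exists c : nat -> M,
    true_in (expand c) (witness (var_bound phi) (fun=> None) 1 phi).
Proof.
move=> Sp sp; set N := var_bound phi.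
(* The empty assignment matches the nowhere defined [e]; fresh constants start at 1 because constant
   0 is reserved for the doubling variable. *)
have HD (s : assignment M) : [set [fmap]] s -> has_dom N (fun=> None) s.
  by move=> -> v _; rewrite fnd_fmap0.
split=> [|[c Hc]]; last first.
  exact: (witness_sound (leqnn N) sp HD (erefl : [set [fmap]] [fmap]) _ Hc).
move=> /(witness_complete (leqnn N) sp)[_ -> IH].
have [a _] := two_elements M.
have [||||| c _ Hc] := IH (fun=> a) (fun=> None) 1 [set [fmap]] _ HD; rewrite //=.
- by split=> s ->; exists [fmap].
- by move=> v /Sp.
- by exists c.
Qed.

(** The induction ranges over all signatures, since each elimination adds constants. The hypothesis
    is applied at the base, in the last expanded signature; the constants are quantified away on the
    way back. *)
Lemma FO_sim0_first_order (F : set dependency) :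
  sentences_first_order (fun sg => @FO sg (F `|` dep_compl @` F)) ->
  sentences_first_order (fun sg => @FO_sim0 sg F).
Proof.
move=> HF sg phi; move en: (sim_lits phi) => n.
elim: n sg phi en => [|n IH] sg phi en Fp Sp.
  have [psi [Fq fq eq]] := FO_sim0_to_FO_compl Fp en.
  have [|chi [Fc Sc ec]] := HF sg psi Fq; first by move=> v /fq /Sp.
  by exists chi; split=> // M; rewrite -ec /true_in eq.
have sp : 0 < sim_lits phi by rewrite en.
have [|||chi [Fc Sc ec]] :=
  IH _ (witness (var_bound phi) (fun=> None) 1 phi).
- by rewrite sim_lits_witness // en.
- exact: FO_sim0_witness.
- by move=> v /free_witness[/Sp|].
have [psi [Fq Sq eq]] := quantify_constants Fc Sc.
exists psi; split=> // M; rewrite eq witness_correct //.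
by split=> -[c /ec Hc]; exists c.
Qed.

Theorem theorem6 (F : set dependency) :
  sentences_first_order (fun sg => @FO_sim0 sg F) <->
  sentences_first_order (fun sg => @FO sg (F `|` dep_compl @` F)).
Proof.
split; last exact: FO_sim0_first_order.
move=> HF sg phi Fp Sp; have [psi [Fq fq eq]] := FO_compl_to_FO_sim0 Fp.
have [|chi [Fc Sc ec]] := HF sg psi Fq; first by move=> v /fq /Sp.
by exists chi; split=> // M; rewrite -ec /true_in eq.
Qed.
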